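(* Let $G=(V,E)$ be a finite connected undirected graph with nonnegative conductances ${\bf c}=(c_{zw})_{zw\in E}$ such that the effective resistance $R_{\rm eff}(\cdot,\cdot)$ on $(G,{\bf c})$ is finite on $V\times V$. For every $\alpha\in[0,1]$, every $x,y\in V$, and every $f:\{0,1\}^V\to\mathbb{R}$, $$\frac{1}{2}\,\nu_\alpha\big[(\nabla_{xy}f)^2\big]\le R_{\rm eff}(x,y)\,\mathcal{E}^{\rm EX}_{(G,{\bf c}),\nu_\alpha}(f).$$
   Context: $G=(V,E)$ is a finite connected undirected graph; $zw\in E$ denotes an (unoriented) edge between $z$ and $w$, and sums over $zw\in E$ count each edge once. The conductances are real numbers $c_{zw}=c_{wz}\ge 0$, $zw\in E$. For $x,y\in V$ (not necessarily adjacent) and $\zeta\in\{0,1\}^V$, $\zeta^{xy}\in\{0,1\}^V$ is the configuration obtained by exchanging the values at $x$ and $y$: $\zeta^{xy}(x)=\zeta(y)$, $\zeta^{xy}(y)=\zeta(x)$, $\zeta^{xy}(z)=\zeta(z)$ for $z\notin\{x,y\}$. For $f:\{0,1\}^V\to\mathbb{R}$, $(\nabla_{xy}f)(\zeta)=f(\zeta^{xy})-f(\zeta)$. For $\alpha\in[0,1]$, $\nu_\alpha$ is the product Bernoulli measure on $\{0,1\}^V$ with marginals $\nu_\alpha\{\zeta:\zeta(x)=1\}=\alpha$ for all $x\in V$. For a measure $\mu$ and integrable $h$, $\mu[h]:=\int h\,d\mu$. The generator of the symmetric exclusion process is $(\mathcal{L}^{\rm EX}_{(G,{\bf c})}f)(\zeta)=\sum_{zw\in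 E}c_{zw}(\nabla_{zw}f)(\zeta)$, and its Dirichlet energy is $$\mathcal{E}^{\rm EX}_{(G,{\bf c}),\nu_\alpha}(f)=\nu_\alpha\big[f(-\mathcal{L}^{\rm EX}_{(G,{\bf c})}f)\big]=\frac12\sum_{zw\in E}c_{zw}\,\nu_\alpha\big[(\nabla_{zw}f)^2\big].$$ The effective resistance $R_{\rm eff}$ on $(G,{\bf c})$ is defined by $$[R_{\rm eff}(x,y)]^{-1}=\inf\Big\{\sum_{zw\in E}c_{zw}[h(z)-h(w)]^2 \;:\; h:V\to\mathbb{R},\ h(x)=1,\ h(y)=0\Big\},$$ with the convention $R_{\rm eff}(x,x)=0$. Its finiteness on $V\times V$ is equivalent to the edges of strictly positive conductance connecting all of $V$. *)

(* Defs.v *)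
From HB Require Import structures.
From mathcomp Require Import all_boot all_order all_algebra.
From mathcomp Require Import all_classical all_reals.

Set Implicit Arguments.
Unset Strict Implicit.
Unset Printing Implicit Defensive.

Import Order.TTheory GRing.Theory Num.Theory.
Local Open Scope ring_scope.

Section Exclusion.
Variables (R : realType) (V : finType).

(* Each unoriented edge is represented once, by the pair listed in increasing
   order of the enumeration of V; every summand F used below is symmetric in
   its two arguments on edges, so the choice of orientation is immaterial. *)
Definition edge_sum (e : rel V) (F : V -> V -> R) : R :=
  \sum_(p : V * V | e p.1 p.2 && (enum_rank p.1 < enum_rank p.2)%N) F p.1 p.2.

Definition config : finType := {ffun V -> bool}.

Definition swap (x y : V) (zeta : config) : config :=
  [ffun z => if z == x then zeta y else if z == y then zeta x else zeta z].

Definition grad (x y : V) (f : config -> R) (zeta : config) : R :=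
  f (swap x y zeta) - f zeta.

(* Mass function of the product Bernoulli measure; the configuration space
   being finite, integration against it is a finite weighted sum. *)
Definition nu_mass (alpha : R) (zeta : config) : R :=
  \prod_(x : V) (if zeta x then alpha else 1 - alpha).

Definition nu (alpha : R) (h : config -> R) : R :=
  \sum_(zeta : config) nu_mass alpha zeta * h zeta.

Definition gen_EX (e : rel V) (c : V -> V -> R) (f : config -> R)
    (zeta : config) : R :=
  edge_sum e (fun z w => c z w * grad z w f zeta).

Definition energy_EX (e : rel V) (c : V -> V -> R) (alpha : R)
    (f : config -> R) : R :=
  nu alpha (fun zeta => f zeta * - gen_EX e c f zeta).

Definition conductance_inf (e : rel V) (c : V -> V -> R) (x y : V) : R :=
  inf [set edge_sum e (fun z w => c z w * (h z - h w) ^+ 2)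
      | h in [set h : V -> R | h x = 1 /\ h y = 0]]%classic.

(* The inverse is taken in the extended reals, where 0^-1 = +oo: the
   resistance is infinite exactly when the infimum vanishes. *)
Definition Reff (e : rel V) (c : V -> V -> R) (x y : V) : \bar R :=
  if x == y then 0%E else ((conductance_inf e c x y)%:E^-1)%E.

End Exclusion.

(* Main.v *)
Require Import Defs.
From HB Require Import structures.
From mathcomp Require Import all_boot all_order all_algebra all_fingroup.
From mathcomp Require Import all_classical all_reals.
From mathcomp Require Import ring lra.

Set Implicit Arguments.
Unset Strict Implicit.
Unset Printing Implicit Defensive.

Import Order.TTheory GRing.Theory Num.Theory.
Local Open Scope ring_scope.

(** Exchanging the contents of two sites acts linearly on the functions f of the
    configuration, and [nu alpha] is invariant under this action of the
    permutations of V.  The proof hence only uses the correlations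
    beta(s) = nu[f(zeta) f(zeta o s)], a symmetric positive definite function on
    the group of permutations; with d(i, j) = beta(1) - beta((i j)), the left
    hand side is d(x, y) and the Dirichlet energy is the sum of c_ij d(i, j)
    over the edges.

    If d(i, j) were a squared distance between points of a Euclidean space
    placed at the vertices, the inequality would be the variational definition
    of the resistance.  Here d is not of that kind, but it satisfies the
    inequality that is needed to eliminate one vertex o of the network
    ([star_mesh_le]): replacing the star of conductances a_i at o by the mesh of
    conductances a_i a_j / sum_k a_k does not increase the energy.  The same
    replacement preserves the electric energy of potentials extended
    harmonically to o.  When every vertex but x and y has been eliminated, one
    conductance w remains, with w d(x, y) bounded by the Dirichlet energy and w
    the electric energy of a potential equal to 1 at x and 0 at y; hence w is
    at least 1 / Reff(x, y) ([network_reduction]).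

    The star-mesh inequality is the octopus inequality of Caputo, Liggett and
    Richthammer ([octopus]): if the real numbers c_i sum to zero and all but one
    of them are nonnegative, then the operator T = sum_ij c_i c_j (i j) is
    nonnegative.  As |T f|^2 >= 0, it is enough to compare T^2 with
    2 (sum c_i^2) T.  Expanding T^2 as a sum over i, j, k, l of
    c_i c_j c_k c_l (i j)(k l), all terms that do not depend on one of the
    four indices may be added or removed freely, because sum c_i = 0.
    This freedom leads to ([quartic_alt4])
      3 T^2 - 6 (sum c_i^2) T = sum c_i c_j c_k c_l A_ijkl
    over distinct indices, where A_ijkl is the sum of the Klein four-group on
    {i, j, k, l} minus half the sum of the 3-cycles, a multiple of the
    projection on the vectors invariant by the Klein group and orthogonal to
    those invariant by the alternating group; so A_ijkl >= 0 ([alt4_ge0]).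
    If o is the exceptional index, the same freedom replaces A_ijkl by
    A_ijkl - A_ojkl - A_iokl - A_ijol - A_ijko with i, j, k, l distinct from o.
    This difference is nonpositive ([alt4_star]), because its opposite is a
    multiple of a self-adjoint idempotent in the group algebra of the
    permutations of {o, i, j, k, l}; and the weights that remain are
    nonnegative, so that T^2 <= 2 (sum c_i^2) T.  The two facts on four and five points are
    identities of the form L * L = m L in group algebras, checked by
    computation. *)

(** * Computing with words in transpositions *)

Section Words.
Variables (V : finType) (n : nat) (x : nat -> V).
Hypothesis x_inj : {in gtn n &, injective x}.

(** The pair (i, j) stands for the transposition of x i and x j, the leftmost
    letter of a word acting first.  Words make products and inverses
    computable, which permutations of an abstract V are not. *)
Definition word := seq (nat * nat).

Definition word_perm (w : word) : {perm V} :=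
  (\prod_(p <- w) tperm (x p.1) (x p.2))%g.

Definition swap_nat (k : nat) (p : nat * nat) : nat :=
  if k == p.1 then p.2 else if k == p.2 then p.1 else k.

Definition word_image (w : word) : seq nat :=
  [seq foldl swap_nat k w | k <- iota 0 n].

Definition word_bounded (w : word) := all (fun p => (p.1 < n) && (p.2 < n))%N w.

Lemma word_perm_nil : word_perm [::] = 1%g.
Proof. by rewrite /word_perm big_nil. Qed.

Lemma word_perm_cat u v : word_perm (u ++ v) = (word_perm u * word_perm v)%g.
Proof. by rewrite /word_perm big_cat. Qed.

Lemma word_perm_rev w : word_perm (rev w) = (word_perm w)^-1%g.
Proof.
elim: w => [|p w IHw]; first by rewrite word_perm_nil invg1.
rewrite rev_cons -cats1 word_perm_cat IHw -[p :: w]cat1s word_perm_cat invMg.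
by rewrite {2 4}/word_perm big_seq1 tpermV.
Qed.

Lemma word_perm_point w k : word_bounded w -> (k < n)%N ->
  (word_perm w) (x k) = x (foldl swap_nat k w).
Proof.
elim: w k => [|p w IHw] k /=; first by rewrite word_perm_nil perm1.
move=> /andP[/andP[p1n p2n] wn] kn.
rewrite /word_perm big_cons permM -/(word_perm w).
have -> : tperm (x p.1) (x p.2) (x k) = x (swap_nat k p).
  rewrite permE /= /swap_nat !(inj_in_eq x_inj) //.
  by case: ifP => // _; case: ifP.
by apply: IHw => //; rewrite /swap_nat; case: ifP => // _; case: ifP.
Qed.

Lemma word_perm_out w v : word_bounded w -> (forall k, (k < n)%N -> v != x k) ->
  (word_perm w) v = v.
Proof.
move=> + vP; elim: w => [|p w IHw] /=; first by rewrite word_perm_nil perm1.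
move=> /andP[/andP[p1n p2n] wn].
rewrite /word_perm big_cons permM -/(word_perm w).
by rewrite tpermD ?IHw // eq_sym vP.
Qed.

(** Only the images of the points x 0, ..., x n.-1 have to be compared, as all
    other points are fixed. *)
Lemma eq_word_perm u v : word_bounded u -> word_bounded v ->
  word_image u = word_image v -> word_perm u = word_perm v.
Proof.
move=> un vn uv; apply/permP => z.
have [[k kn ->]|z_out] := pselect (exists2 k, (k < n)%N & z = x k).
  rewrite !word_perm_point //; congr x.
  have /(congr1 (fun s => nth 0%N s k)) := uv.
  by rewrite !(nth_map 0%N) ?size_iota // nth_iota.
rewrite !word_perm_out // => k kn; apply/eqP => zk;
  by apply: z_out; exists k.
Qed.

Section Eval.
Variables (R : realFieldType) (beta : {perm V} -> R).

(** A list of weighted words is an element of the group algebra with integer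
    coefficients; [beta] is extended to it linearly. *)
Definition eval (L : seq (int * word)) : R :=
  \sum_(p <- L) p.1%:~R * beta (word_perm p.2).

(** Like terms are gathered in an association list, so that the cancellation of
    all coefficients can be decided by evaluation. *)
Fixpoint collect_term (a : int) (u : seq nat) (T : seq (int * seq nat)) :=
  if T is (b, v) :: T' then
    if u == v then (a + b, v) :: T' else (b, v) :: collect_term a u T'
  else [:: (a, u)].

Definition collect (L : seq (int * word)) : seq (int * seq nat) :=
  foldr (fun p => collect_term p.1 (word_image p.2)) [::] L.

Lemma sum_collect (B : seq nat -> R) L :
  \sum_(p <- collect L) p.1%:~R * B p.2 =
  \sum_(p <- L) p.1%:~R * B (word_image p.2).
Proof.
elim: L => [|[a w] L IHL] /=; first by rewrite !big_nil.
rewrite big_cons -IHL /=; move: (collect L) (word_image w) => T u {IHL}.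
elim: T => [|[b v] T IHT] /=; first by rewrite big_seq1 big_nil addr0.
case: eqP => [->|_]; rewrite !big_cons /=; first by rewrite intrD mulrDl addrA.
by rewrite IHT addrCA.
Qed.

Definition words_bounded (L : seq (int * word)) :=
  all (fun p => word_bounded p.2) L.

Lemma eval_eq0 L : words_bounded L ->
  all (fun p => p.1 == 0) (collect L) -> eval L = 0.
Proof.
move=> Lb /allP L0.
(* beta factors through the images of words: B u is its value on the first word
   of L with images u. *)
pose B u := beta (word_perm (nth [::] (unzip2 L)
  (index u [seq word_image p.2 | p <- L]))).
have BE p : p \in L -> beta (word_perm p.2) = B (word_image p.2).
  move=> pL; rewrite /B; set u := word_image _.
  set i := index _ _.
  have iL : (i < size L)%N.
    by rewrite -(size_map (fun p => word_image p.2)) index_mem; exact: map_f.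
  have wE : nth [::] (unzip2 L) i = (nth (0, [::]) L i).2.
    by rewrite (nth_map (0, [::])).
  congr beta; apply: eq_word_perm.
  - exact: (allP Lb).
  - by rewrite wE; apply: (allP Lb); rewrite mem_nth.
  rewrite wE -(nth_map (0, [::]) [::] (fun p => word_image p.2)) //.
  by rewrite nth_index //; apply: map_f.
rewrite /eval (eq_big_seq (fun p => p.1%:~R * B (word_image p.2))); last first.
  by move=> p pL; rewrite BE.
by rewrite -sum_collect big1_seq // => p /andP[_ /L0 /eqP ->]; rewrite mul0r.
Qed.

Lemma eval_cat L M : eval (L ++ M) = eval L + eval M.
Proof. exact: big_cat. Qed.

Definition scale (a : int) (L : seq (int * word)) :=
  [seq (a * p.1, p.2) | p <- L].
Definition inverse (L : seq (int * word)) := [seq (p.1, rev p.2) | p <- L].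
(** The product of L by its adjoint. *)
Definition gram (L : seq (int * word)) :=
  flatten [seq [seq (p.1 * q.1, p.2 ++ rev q.2) | q <- L] | p <- L].

Lemma eval_scale a L : eval (scale a L) = a%:~R * eval L.
Proof.
rewrite /eval big_map big_distrr; apply: eq_bigr => p _ /=.
by rewrite intrM mulrA.
Qed.

Lemma eval_inverse L : (forall s, beta s^-1%g = beta s) ->
  eval (inverse L) = eval L.
Proof.
move=> bV; rewrite /eval big_map; apply: eq_bigr => p _ /=.
by rewrite word_perm_rev bV.
Qed.

End Eval.
End Words.

(** Symmetry is a separate clause: over the reals, the inequality alone only
    constrains beta(s) + beta(s^-1). *)
Definition positive_definite (R : realFieldType) (V : finType)
    (beta : {perm V} -> R) : Prop :=
  (forall s, beta s^-1%g = beta s) /\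
  forall (I : Type) (r : seq I) (a : I -> R) (s : I -> {perm V}),
    0 <= \sum_(p <- r) \sum_(q <- r) a p * a q * beta (s p * (s q)^-1)%g.

Section PositiveDefinite.
Variables (R : realFieldType) (V : finType) (beta : {perm V} -> R).
Hypothesis beta_pd : positive_definite beta.

Lemma eval_gram_ge0 x L : 0 <= eval x beta (gram L).
Proof.
have [bV pd] := beta_pd.
have := pd _ L (fun p => p.1%:~R) (fun p => word_perm x p.2).
rewrite /eval /gram big_flatten /= big_map.
congr (0 <= _); apply: eq_bigr => p _; rewrite big_map; apply: eq_bigr => q _.
by rewrite word_perm_cat word_perm_rev intrM.
Qed.

(** The identity gram L = k M holds only up to replacing permutations by their
    inverses, which [beta] does not see; the difference is therefore added to
    its own image under inversion. *)
Definition proportional n (k : int) L M :=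
  let D := gram L ++ scale (- k) M in let D' := D ++ inverse D in
  words_bounded n D' && all (fun p => p.1 == 0) (collect n D').

Lemma eval_proportional_ge0 n x (k : nat) L M :
  {in gtn n &, injective x} -> proportional n k.+1 L M ->
  0 <= eval x beta M.
Proof.
move=> x_inj /andP[Db D0]; have [bV _] := beta_pd.
have := eval_eq0 x_inj beta Db D0.
rewrite !(eval_cat, eval_inverse, eval_scale) //.
have := eval_gram_ge0 x L.
rewrite mulrNz => g0.
rewrite -mulr2n => /eqP; rewrite mulrn_eq0 /= mulNr subr_eq0 => /eqP gE.
by move: g0; rewrite gE pmulr_rge0 // ltr0z.
Qed.

End PositiveDefinite.

Definition swap2 (i j k l : nat) : word := [:: (i, j); (k, l)].
(** The sum of the Klein four-group on {i, j, k, l}, minus one 3-cycle for each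
    triple of points. *)
Definition alt4_words (i j k l : nat) : seq (int * word) :=
  [:: (1, [::]); (1, swap2 i j k l); (1, swap2 i k j l); (1, swap2 i l j k);
      (-1, swap2 i j i k); (-1, swap2 i j i l);
      (-1, swap2 i k i l); (-1, swap2 j k j l)].

(** Twice the previous element, made self-adjoint: A = 3 K - G, with K and G
    the sums of the Klein group and of the alternating group on four points.
    Since K K = 4 K, K G = 4 G and G G = 12 G, it satisfies A A = 12 A. *)
Definition alt4_sym := alt4_words 0 1 2 3 ++ inverse (alt4_words 0 1 2 3).

(** Half of M - 2 A, where A is the self-adjoint element above for the points
    1, 2, 3, 4 and M is the sum of such elements over the five sets of four
    points among 0, ..., 4.  As M is central, with M M = 24 M, M A = 24 A
    and A A = 12 A, the square of M - 2 A is 24 (M - 2 A).  The 3-cycles that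
    fix 0 cancel out. *)
Definition star_idempotent : seq (int * word) :=
  (3, [::])
  :: [seq (-1 : int, swap2 0 p.1 0 p.2) | p <-
       [:: (1, 2); (2, 1); (1, 3); (3, 1); (1, 4); (4, 1);
           (2, 3); (3, 2); (2, 4); (4, 2); (3, 4); (4, 3)]%N]
  ++ [seq (1 : int, w) | w <-
       [:: swap2 0 1 2 3; swap2 0 2 1 3; swap2 0 3 1 2;
           swap2 0 1 2 4; swap2 0 2 1 4; swap2 0 4 1 2;
           swap2 0 1 3 4; swap2 0 3 1 4; swap2 0 4 1 3;
           swap2 0 2 3 4; swap2 0 3 2 4; swap2 0 4 2 3]]
  ++ [seq (-1 : int, w) | w <-
       [:: swap2 1 2 3 4; swap2 1 3 2 4; swap2 1 4 2 3]].

Definition star_words :=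
  alt4_words 0 2 3 4 ++ alt4_words 1 0 3 4 ++ alt4_words 1 2 0 4
  ++ alt4_words 1 2 3 0 ++ scale (-1) (alt4_words 1 2 3 4).

(** With Y = [star_idempotent], Y Y = 12 Y, and Y equals [star_words] modulo
    inversion of the 3-cycles. *)
Lemma star_certificate : proportional 5 12 star_idempotent star_words.
Proof. reflexivity. Qed.

Lemma alt4_certificate : proportional 4 24 alt4_sym (alt4_words 0 1 2 3).
Proof. reflexivity. Qed.

(** * Quartic forms with weights of zero sum *)

Section Quartic.
Variables (R : realFieldType) (V : finType) (c : V -> R).

Definition quartic (X : V -> V -> V -> V -> R) : R :=
  \sum_i \sum_j \sum_k \sum_l c i * c j * c k * c l * X i j k l.

Lemma eq_quartic X Y : (forall i j k l, X i j k l = Y i j k l) ->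
  quartic X = quartic Y.
Proof.
by move=> XY; do 4![apply: eq_bigr => ? _]; rewrite XY.
Qed.

Lemma quarticD X Y :
  quartic (fun i j k l => X i j k l + Y i j k l) = quartic X + quartic Y.
Proof.
rewrite /quartic -!big_split; apply: eq_bigr => i _ /=.
rewrite -!big_split; apply: eq_bigr => j _ /=.
rewrite -!big_split; apply: eq_bigr => k _ /=.
by rewrite -!big_split; apply: eq_bigr => l _ /=; rewrite mulrDr.
Qed.

Lemma quarticN X : quartic (fun i j k l => - X i j k l) = - quartic X.
Proof.
rewrite /quartic -!sumrN; apply: eq_bigr => i _ /=.
rewrite -!sumrN; apply: eq_bigr => j _ /=.
rewrite -!sumrN; apply: eq_bigr => k _ /=.
by rewrite -!sumrN; apply: eq_bigr => l _ /=; rewrite mulrN.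
Qed.

Lemma quartic_swap12 X : quartic (fun i j k l => X j i k l) = quartic X.
Proof.
rewrite /quartic exchange_big; apply: eq_bigr => i _; apply: eq_bigr => j _.
by apply: eq_bigr => k _; apply: eq_bigr => l _; rewrite (mulrC (c j)).
Qed.

Lemma quartic_swap23 X : quartic (fun i j k l => X i k j l) = quartic X.
Proof.
rewrite /quartic; apply: eq_bigr => i _; rewrite exchange_big.
apply: eq_bigr => j _; apply: eq_bigr => k _; apply: eq_bigr => l _ /=.
by rewrite (mulrAC (c i)).
Qed.

Lemma quartic_swap34 X : quartic (fun i j k l => X i j l k) = quartic X.
Proof.
rewrite /quartic; apply: eq_bigr => i _; apply: eq_bigr => j _.
rewrite exchange_big; apply: eq_bigr => k _; apply: eq_bigr => l _ /=.
by rewrite (mulrAC (c i * c j)).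
Qed.

Hypothesis c_sum0 : \sum_i c i = 0.

Lemma quartic_free4 U : quartic (fun i j k l => U i j k) = 0.
Proof.
rewrite /quartic big1 // => i _; rewrite big1 // => j _; rewrite big1 // => k _.
by rewrite -big_distrl -big_distrr /= c_sum0 mulr0 mul0r.
Qed.

Lemma quartic_free3 U : quartic (fun i j k l => U i j l) = 0.
Proof. by rewrite -quartic_swap34 quartic_free4. Qed.

Lemma quartic_free2 U : quartic (fun i j k l => U i k l) = 0.
Proof. by rewrite -quartic_swap23 quartic_free3. Qed.

Lemma quartic_free1 U : quartic (fun i j k l => U j k l) = 0.
Proof. by rewrite -quartic_swap12 quartic_free2. Qed.

(** The device behind the octopus inequality: quartic sums may be computed modulo
    functions of three of the four indices. *)
Lemma quartic_mod X Y U1 U2 U3 U4 :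
  (forall i j k l,
    X i j k l = Y i j k l + U1 j k l + U2 i k l + U3 i j l + U4 i j k) ->
  quartic X = quartic Y.
Proof.
move=> XY; rewrite (eq_quartic XY) 4!quarticD.
by rewrite quartic_free1 quartic_free2 quartic_free3 quartic_free4 !addr0.
Qed.

End Quartic.

(** * The octopus inequality *)

Section Octopus.
Variables (R : realFieldType) (V : finType) (beta : {perm V} -> R).
Hypothesis beta_pd : positive_definite beta.

Local Notation t := tperm.

Let betaV s : beta s^-1%g = beta s. Proof. by case: beta_pd. Qed.

Let betaC i j k l : beta (t i j * t k l)%g = beta (t k l * t i j)%g.
Proof. by rewrite -betaV invMg !tpermV. Qed.

Definition alt4 i j k l : R :=
  beta 1%g + beta (t i j * t k l)%g + beta (t i k * t j l)%g
  + beta (t i l * t j k)%g - beta (t i j * t i k)%g - beta (t i j * t i l)%g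
  - beta (t i k * t i l)%g - beta (t j k * t j l)%g.

Lemma eval_alt4_words x i j k l :
  eval x beta (alt4_words i j k l) = alt4 (x i) (x j) (x k) (x l).
Proof.
rewrite /eval /alt4_words !big_cons big_nil /= /word_perm !big_cons !big_nil /=.
rewrite !mulg1 /alt4; ring.
Qed.

Lemma nth_uniq_inj (o : V) s :
  uniq s -> {in gtn (size s) &, injective (nth o s)}.
Proof. by move=> us i j /= iI jI /eqP; rewrite nth_uniq // => /eqP. Qed.

Lemma alt4_ge0 i j k l : uniq [:: i; j; k; l] -> 0 <= alt4 i j k l.
Proof.
move=> /(nth_uniq_inj (o := i)) x_inj.
have := eval_proportional_ge0 beta_pd x_inj alt4_certificate.
by rewrite eval_alt4_words.
Qed.

(** Five points: the four sets containing o outweigh the one that does not. *)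
Lemma alt4_star o i j k l : uniq [:: o; i; j; k; l] ->
  alt4 i j k l <= alt4 o j k l + alt4 i o k l + alt4 i j o l + alt4 i j k o.
Proof.
move=> /(nth_uniq_inj (o := o)) x_inj.
have := eval_proportional_ge0 beta_pd x_inj star_certificate.
rewrite /star_words !eval_cat eval_scale !eval_alt4_words /=; lra.
Qed.

(** The correction at j = k depends on i, j, k only, so that it is invisible to
    [quartic_mod]; it makes the expression symmetric in its arguments, equal to
    beta((u v)) as soon as they take only two values u and v. *)
Definition three_cycle i j k : R :=
  beta (t i j * t i k)%g + (j == k)%:R * (beta (t i j) - beta 1%g).

Lemma three_cycleC23 i j k : three_cycle i k j = three_cycle i j k.
Proof.
by rewrite /three_cycle betaC eq_sym; case: eqVneq => [->|_] //; rewrite !mul0r.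
Qed.

Lemma three_cycleC12 i j k : three_cycle j i k = three_cycle i j k.
Proof.
rewrite /three_cycle.
have [->//|ij] := eqVneq i j.
have [jk|jk] := eqVneq j k.
  by rewrite -jk (negPf ij) tperm1 mulg1 tperm2 (tpermC j i) /=; ring.
have [ik|ik] := eqVneq i k.
  by rewrite -ik tperm1 mulg1 tperm2 (tpermC j i) /=; ring.
rewrite !mul0r !addr0 -[RHS]betaV invMg !tpermV; congr beta.
apply/permP => z; rewrite !permE /= !permE /=.
have neqs := (negPf ij, negPf ik, negPf jk, eq_sym j i, eq_sym k i, eq_sym k j).
have [zj|zj] := eqVneq z j.
  by rewrite zj /= ?(neqs, eqxx) /= ?(neqs, eqxx).
have [zi|zi] := eqVneq z i.
  by rewrite /= ?(neqs, eqxx) /= ?(neqs, eqxx).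
rewrite /= ?(negPf zi) (negPf zj); have [zk|zk] := eqVneq z k.
  by rewrite eqxx.
by rewrite (negPf zi) (negPf zj).
Qed.

(** What [alt4], corrected as above, is worth when i = j.  The product of this
    collision by beta((k l)) is the only term that depends on all four indices,
    and it produces the sum of the c_i^2. *)
Definition collide i j k l : R :=
  (i == j)%:R * (beta 1%g + beta (t k l) - beta (t i k) - beta (t i l)).

Definition two_swaps i j k l : R := beta (t i j * t k l)%g.

(** Subtracting the values at the six possible collisions leaves a symmetric
    function of the indices that vanishes unless they are distinct, also when
    several collisions occur at the same time. *)
Definition alt4_full i j k l : R :=
  beta 1%g + two_swaps i j k l + two_swaps i k j l + two_swaps i l j k
  - three_cycle i j k - three_cycle i j l - three_cycle i k l
  - three_cycle j k l
  - collide i j k l - collide i k j l - collide i l j k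
  - collide j k i l - collide j l i k - collide k l i j.

Lemma collideC12 i j k l : collide j i k l = collide i j k l.
Proof.
by rewrite /collide eq_sym; case: eqVneq => [->|_] //; rewrite !mul0r.
Qed.

Lemma collideC34 i j k l : collide i j l k = collide i j k l.
Proof. by rewrite /collide (tpermC l k); ring. Qed.

Lemma two_swapsC12 i j k l : two_swaps j i k l = two_swaps i j k l.
Proof. by rewrite /two_swaps tpermC. Qed.

Lemma two_swapsC34 i j k l : two_swaps i j l k = two_swaps i j k l.
Proof. by rewrite /two_swaps (tpermC k). Qed.

Lemma two_swapsC i j k l : two_swaps k l i j = two_swaps i j k l.
Proof. by rewrite /two_swaps betaC. Qed.

Lemma alt4_fullC12 i j k l : alt4_full j i k l = alt4_full i j k l.
Proof.
rewrite /alt4_full (two_swapsC12 i j) (two_swapsC i l j k) (two_swapsC i k j l).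
rewrite !(three_cycleC12 i j) (collideC12 i j) (collideC34 k l i j); ring.
Qed.

Lemma alt4_fullC23 i j k l : alt4_full i k j l = alt4_full i j k l.
Proof.
rewrite /alt4_full (two_swapsC34 _ _ j k).
rewrite (three_cycleC23 i j k) (three_cycleC12 j k l).
rewrite (collideC34 _ _ j k) (collideC12 j k); ring.
Qed.

Lemma alt4_fullC34 i j k l : alt4_full i j l k = alt4_full i j k l.
Proof.
rewrite /alt4_full (two_swapsC34 _ _ k l).
rewrite (three_cycleC23 _ k l) (three_cycleC23 _ k l).
rewrite (collideC34 _ _ k l) (collideC12 k l); ring.
Qed.

Lemma alt4_full_collision i k l : alt4_full i i k l = 0.
Proof.
have r1 z w : three_cycle z z w = beta (t z w).
  rewrite /three_cycle tperm1 mul1g; case: eqP => [->|_]; last by ring.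
  by rewrite tperm1 /=; ring.
rewrite /alt4_full /two_swaps !r1 tperm1 mul1g.
rewrite /three_cycle /collide eqxx tperm1.
rewrite (betaC i l) (tpermC k i).
by case: (eqVneq k l) => [->|_] /=; rewrite ?tperm1; ring.
Qed.

Definition alt4_uniq i j k l : R :=
  if uniq [:: i; j; k; l] then alt4 i j k l else 0.

Lemma alt4_fullE i j k l : alt4_full i j k l = alt4_uniq i j k l.
Proof.
rewrite /alt4_uniq.
have [ij|ij] := eqVneq i j.
  by rewrite ij alt4_full_collision /= inE eqxx.
have [ik|ik] := eqVneq i k.
  by rewrite ik -alt4_fullC23 alt4_full_collision /= !inE eqxx orbT.
have [jk|jk] := eqVneq j k.
  rewrite jk -alt4_fullC12 -alt4_fullC23 alt4_full_collision.
  by rewrite /= !inE eqxx andbF.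
have [il|il] := eqVneq i l.
  rewrite il -alt4_fullC34 -alt4_fullC23 alt4_full_collision.
  by rewrite /= !inE eqxx !orbT.
have [jl|jl] := eqVneq j l.
  rewrite jl -alt4_fullC34 -alt4_fullC12 -alt4_fullC23 alt4_full_collision.
  by rewrite /= !inE eqxx !orbT andbF.
have [kl|kl] := eqVneq k l.
  rewrite kl -alt4_fullC23 -alt4_fullC34 -alt4_fullC12 -alt4_fullC23.
  by rewrite alt4_full_collision /= !inE eqxx !andbF.
rewrite /= !inE !negb_or ij ik il jk jl kl /=.
rewrite /alt4_full /three_cycle /collide /alt4 /two_swaps.
rewrite (negPf ij) (negPf ik) (negPf il) (negPf jk) (negPf jl) (negPf kl) /=.
ring.
Qed.


Lemma alt4_uniq_ge0 i j k l : 0 <= alt4_uniq i j k l.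
Proof. by rewrite /alt4_uniq; case: ifP => // /alt4_ge0. Qed.

Lemma alt4_uniq_star o i j k l : o != i -> o != j -> o != k -> o != l ->
  alt4_uniq i j k l <= alt4_uniq o j k l + alt4_uniq i o k l
    + alt4_uniq i j o l + alt4_uniq i j k o.
Proof.
move=> oi oj ok ol; rewrite {1}/alt4_uniq; case: ifP => [u|_]; last first.
  by rewrite !addr_ge0 ?alt4_uniq_ge0.
have u5 : uniq [:: o; i; j; k; l].
  by rewrite cons_uniq u !inE !negb_or oi oj ok ol.
move: (u5) (alt4_star u5) => /=; rewrite !inE !negb_or => /and5P[/and4P[]].
move=> _ _ _ _ /and3P[ij ik il] /andP[jk jl] kl _.
rewrite /alt4_uniq /= !inE !negb_or.
by rewrite !(eq_sym _ o) oi oj ok ol ij ik il jk jl kl.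
Qed.

Variables (c : V -> R) (o : V).
Hypothesis c_sum0 : \sum_i c i = 0.
Hypothesis c_ge0 : forall i, i != o -> 0 <= c i.

Local Notation Q := (quartic c).

(** Subtracting the functions obtained by replacing one index by o changes
    nothing, and cancels all summands that involve o; the weights of the others
    are nonnegative. *)
Lemma quartic_alt4_le0 : Q alt4_uniq <= 0.
Proof.
rewrite -oppr_ge0 -quarticN (quartic_mod c_sum0 (Y := fun i j k l =>
  alt4_uniq o j k l + alt4_uniq i o k l + alt4_uniq i j o l
  + alt4_uniq i j k o - alt4_uniq i j k l)
  (U1 := fun j k l => - alt4_uniq o j k l)
  (U2 := fun i k l => - alt4_uniq i o k l)
  (U3 := fun i j l => - alt4_uniq i j o l)
  (U4 := fun i j k => - alt4_uniq i j k o)); last by move=> i j k l; ring.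
apply: sumr_ge0 => i _; apply: sumr_ge0 => j _.
apply: sumr_ge0 => k _; apply: sumr_ge0 => l _.
set D := (X in _ * X).
have D0 : (o == i) || (o == j) || (o == k) || (o == l) -> D = 0.
  rewrite /D /alt4_uniq /= !inE; move=> /orP[/orP[/orP[]|]|] /eqP <-;
  by rewrite !eqxx ?(orbT, andbF) /=; ring.
have [/D0 ->|] := boolP ((o == i) || (o == j) || (o == k) || (o == l)).
  by rewrite mulr0.
rewrite !negb_or => /andP[/andP[/andP[oi oj] ok] ol].
rewrite mulr_ge0 ?subr_ge0 ?alt4_uniq_star //.
by rewrite !mulr_ge0 ?c_ge0 // eq_sym.
Qed.

Let swap_form : R := \sum_i \sum_j c i * c j * beta (t i j).

(** This is |T f|^2 >= 0 for T = sum_ij c_i c_j (i j). *)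
Lemma quartic_two_swaps_ge0 : 0 <= Q two_swaps.
Proof.
have [_ pd] := beta_pd.
have := pd _ (index_enum (V * V)%type) (fun p => c p.1 * c p.2)
  (fun p => t p.1 p.2).
congr (0 <= _); rewrite /quartic [RHS]pair_bigA; apply: eq_bigr => -[i j] _ /=.
rewrite [RHS]pair_bigA; apply: eq_bigr => -[k l] _ /=.
by rewrite tpermV mulrA.
Qed.

Lemma quartic_diagonal :
  Q (fun i j k l => (i == j)%:R * beta (t k l)) = (\sum_i c i ^+ 2) * swap_form.
Proof.
rewrite /quartic big_distrl; apply: eq_bigr => i _ /=.
rewrite (bigD1 i) //= [X in _ + X]big1 ?addr0 => [|j ji]; last first.
  rewrite eq_sym (negPf ji) big1 // => k _; rewrite big1 // => l _ /=.
  by rewrite mul0r mulr0.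
rewrite big_distrr; apply: eq_bigr => k _; rewrite big_distrr.
by apply: eq_bigr => l _; rewrite eqxx /=; ring.
Qed.

(** The identity 3 T^2 - 6 (sum_i c_i^2) T = sum of the A_ijkl: three pairings
    of four indices give T^2, and six collisions give (sum_i c_i^2) T. *)
Lemma quartic_alt4 :
  Q alt4_uniq = 3 * Q two_swaps - 6 * ((\sum_i c i ^+ 2) * swap_form).
Proof.
pose diag (i j k l : V) : R := (i == j)%:R * beta (t k l).
rewrite -quartic_diagonal -/diag -(eq_quartic _ alt4_fullE).
pose tri (i j k : V) : R := (i == j)%:R * (beta (t i k) - beta 1%g / 2).
rewrite (quartic_mod c_sum0 (Y := fun i j k l =>
  two_swaps i j k l + two_swaps i k j l + two_swaps i l j k
  + - diag i j k l + - diag i k j l + - diag i l j k + - diag j k i l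
  + - diag j l i k + - diag k l i j)
  (U1 := fun j k l => beta 1%g - three_cycle j k l
     + tri j k l + tri j l k + tri k l j)
  (U2 := fun i k l => - three_cycle i k l + tri i k l + tri i l k + tri k l i)
  (U3 := fun i j l => - three_cycle i j l + tri i j l + tri i l j + tri j l i)
  (U4 := fun i j k => - three_cycle i j k + tri i j k + tri i k j + tri j k i));
  last first.
  move=> i j k l; rewrite /alt4_full /collide /tri /diag.
  (* beta 1 occurs once in each collision, and is shared between its two tri
     terms. *)
  rewrite (_ : (beta 1%g : R) = beta 1%g / 2 + beta 1%g / 2); last by field.
  by field.
rewrite 8!quarticD !quarticN.
have b23 : Q (fun i j k l => two_swaps i k j l) = Q two_swaps.
  exact: quartic_swap23.
have b24 : Q (fun i j k l => two_swaps i l j k) = Q two_swaps.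
  by rewrite -b23; exact: (quartic_swap34 c (fun i j k l => two_swaps i k j l)).
have d23 : Q (fun i j k l => diag i k j l) = Q diag by exact: quartic_swap23.
have d24 : Q (fun i j k l => diag i l j k) = Q diag.
  by rewrite -d23; exact: (quartic_swap34 c (fun i j k l => diag i k j l)).
have d13 : Q (fun i j k l => diag j k i l) = Q diag.
  by rewrite -d23; exact: (quartic_swap12 c (fun i j k l => diag i k j l)).
have d14 : Q (fun i j k l => diag j l i k) = Q diag.
  by rewrite -d24; exact: (quartic_swap12 c (fun i j k l => diag i l j k)).
have d34 : Q (fun i j k l => diag k l i j) = Q diag.
  by rewrite -d14; exact: (quartic_swap23 c (fun i j k l => diag j l i k)).
rewrite b23 b24 d13 d14 d34 d23 d24; ring.
Qed.

(** With p = sum_i c_i^2, the two preceding facts give 2 p T >= T^2 >= 0. *)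
Lemma octopus : 0 <= \sum_i \sum_j c i * c j * beta (tperm i j).
Proof.
rewrite -/swap_form.
have := quartic_alt4_le0; rewrite quartic_alt4.
have := quartic_two_swaps_ge0.
have [c0|cN0] := eqVneq (\sum_i c i ^+ 2) 0.
  move=> _ _; rewrite /swap_form big1 // => i _; rewrite big1 // => j _.
  have /eqP : c i ^+ 2 = 0.
    by apply: (psumr_eq0P _ c0) => // k _; rewrite sqr_ge0.
  by rewrite sqrf_eq0 => /eqP ->; rewrite !mul0r.
have cgt0 : 0 < \sum_i c i ^+ 2.
  by rewrite lt_def cN0 sumr_ge0 // => i _; rewrite sqr_ge0.
move=> d0 le0; rewrite -(pmulr_rge0 _ cgt0); lra.
Qed.

End Octopus.

(** * Eliminating the vertices of a network *)

Section Network.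
Variables (R : realFieldType) (V : finType).

(** Ordered pairs are summed, hence each edge is counted twice. *)
Definition pairing (w F : V -> V -> R) : R := \sum_i \sum_j w i j * F i j.

Definition star_mesh_le (d : V -> V -> R) : Prop :=
  forall (a : V -> R) (o : V), (forall i, 0 <= a i) -> a o = 0 ->
    \sum_i \sum_j a i * a j * d i j <= 2 * (\sum_i a i) * \sum_i a i * d o i.

Definition branches (w : V -> V -> R) o i : R := if i == o then 0 else w o i.

Definition remainder (w : V -> V -> R) o i j : R :=
  if (i == o) || (j == o) then 0 else w i j.

(** The mesh has nonzero loops, harmless against functions that vanish on the
    diagonal; when o carries no branch, the division by zero makes the added
    term vanish, as it should. *)
Definition mesh (w : V -> V -> R) o i j : R :=
  remainder w o i j
  + branches w o i * branches w o j / \sum_k branches w o k.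

Lemma pairing_split w F o :
  (forall i j, w i j = w j i) -> (forall i j, F i j = F j i) -> F o o = 0 ->
  pairing w F = pairing (remainder w o) F + 2 * \sum_i branches w o i * F o i.
Proof.
move=> wC FC F0.
have -> : pairing w F = \sum_i \sum_j (remainder w o i j * F i j
    + ((i == o)%:R * (branches w o j * F o j)
    + (j == o)%:R * (branches w o i * F o i))).
  apply: eq_bigr => i _; apply: eq_bigr => j _; rewrite /remainder /branches.
  case: (eqVneq i o) => [->|io]; case: (eqVneq j o) => [->|jo] /=;
    rewrite ?F0 ?(wC i o) ?(FC i o); ring.
rewrite /pairing mulr_natl mulr2n.
under eq_bigr do rewrite big_split /=.
rewrite big_split /=; congr (_ + _).
under eq_bigr do rewrite big_split /=.
rewrite big_split /=; congr (_ + _).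
  rewrite (bigD1 o) //= [X in _ + X]big1 ?addr0 => [|i /negPf ->]; last first.
    by rewrite big1 // => j _; rewrite mul0r.
  by apply: eq_bigr => j _; rewrite eqxx mul1r.
apply: eq_bigr => i _.
rewrite (bigD1 o) //= big1 ?addr0 => [|j /negPf ->]; last by rewrite mul0r.
by rewrite eqxx mul1r.
Qed.

Lemma pairing_mesh w F o : pairing (mesh w o) F = pairing (remainder w o) F
  + (\sum_i \sum_j branches w o i * branches w o j * F i j)
    / \sum_k branches w o k.
Proof.
rewrite /pairing big_distrl -big_split; apply: eq_bigr => i _ /=.
rewrite big_distrl -big_split; apply: eq_bigr => j _ /=.
by rewrite /mesh; ring.
Qed.

Lemma variance_double_sum (a h : V -> R) :
  \sum_i \sum_j a i * a j * (h i - h j) ^+ 2 =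
  2 * (\sum_i a i) * (\sum_i a i * h i ^+ 2) - 2 * (\sum_i a i * h i) ^+ 2.
Proof.
have -> : \sum_i \sum_j a i * a j * (h i - h j) ^+ 2 =
    \sum_i (a i * h i ^+ 2 * (\sum_j a j) + a i * (\sum_j a j * h j ^+ 2)
      - 2 * (a i * h i) * (\sum_j a j * h j)).
  apply: eq_bigr => i _.
  rewrite !big_distrr -big_split -sumrB; apply: eq_bigr => j _ /=; ring.
rewrite sumrB big_split /= -!big_distrl /= -big_distrr /=; ring.
Qed.

Lemma variance_center (a h : V -> R) m :
  \sum_i a i * (m - h i) ^+ 2 = m ^+ 2 * (\sum_i a i)
    - 2 * m * (\sum_i a i * h i) + \sum_i a i * h i ^+ 2.
Proof.
rewrite !big_distrr -sumrB -big_split; apply: eq_bigr => i _ /=; ring.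
Qed.

(** The value at o is the weighted mean of its neighbours, and minimizes the
    energy of the star.  That minimum is the energy of the mesh, as centred
    squares and squared differences of pairs both compute a variance. *)
Lemma harmonic_extension (w : V -> V -> R) o (h : V -> R) :
  (forall i j, 0 <= w i j) -> (forall i j, w i j = w j i) ->
  exists h' : V -> R, (forall i, i != o -> h' i = h i) /\
    pairing w (fun i j => (h' i - h' j) ^+ 2)
    = pairing (mesh w o) (fun i j => (h i - h j) ^+ 2).
Proof.
move=> w0 wC; set a := branches w o; set W := \sum_i a i.
have a0 i : 0 <= a i by rewrite /a /branches; case: ifP.
pose m := (\sum_i a i * h i) / W.
exists (fun i => if i == o then m else h i); split=> [i /negPf ->//|].
rewrite (pairing_split (o := o)) //; last 2 first.
- by move=> i j; ring.
- by rewrite subrr expr0n.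
rewrite pairing_mesh -/a -/W; congr (_ + _).
  apply: eq_bigr => i _; apply: eq_bigr => j _; rewrite /remainder.
  by case: (eqVneq i o); case: (eqVneq j o); rewrite ?mul0r.
rewrite eqxx (eq_bigr (fun i => a i * (m - h i) ^+ 2)); last first.
  by move=> i _; rewrite -/(a i) /a /branches; case: ifP; rewrite ?mul0r.
rewrite variance_double_sum variance_center -/W.
have [W0|WN0] := eqVneq W 0.
  have az i : a i = 0 by apply: (psumr_eq0P _ W0).
  rewrite W0 invr0 mulr0.
  rewrite [\sum_i a i * h i]big1 => [|i _]; last by rewrite az mul0r.
  by rewrite big1 => [|i _]; [ring|rewrite az mul0r].
by rewrite /m; field.
Qed.

Section Reduction.
Variables (d : V -> V -> R).
Hypothesis d_ge0 : forall i j, 0 <= d i j.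
Hypothesis dC : forall i j, d i j = d j i.
Hypothesis dd : forall i, d i i = 0.
Hypothesis d_star : star_mesh_le d.

Lemma pairing_mesh_le w o : (forall i j, 0 <= w i j) ->
  (forall i j, w i j = w j i) -> pairing (mesh w o) d <= pairing w d.
Proof.
move=> w0 wC; rewrite (pairing_split (w := w) (o := o)) // pairing_mesh lerD2l.
set a := branches w o.
have a0 i : 0 <= a i by rewrite /a /branches; case: ifP.
have := d_star a0 (_ : a o = 0); rewrite {1}/a /branches eqxx => /(_ erefl).
have : 0 <= \sum_i a i by exact: sumr_ge0.
rewrite le_eqVlt => /predU1P[<- _|W0 star].
  by rewrite invr0 mulr0 mulr_ge0 //; apply: sumr_ge0 => i _; rewrite mulr_ge0.
by rewrite ler_pdivrMr // mulrAC.
Qed.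

(** Induction on the number of vertices other than x and y that carry a
    conductance.  When there are none, the potential is the indicator of x. *)
Lemma network_reduction (w : V -> V -> R) x y :
  (forall i j, 0 <= w i j) -> (forall i j, w i j = w j i) -> x != y ->
  exists h : V -> R, [/\ h x = 1, h y = 0 &
    pairing w (fun i j => (h i - h j) ^+ 2) * d x y <= pairing w d].
Proof.
move=> w0 wC xy.
have [n] := ubnP #|[set o | [&& o != x, o != y & [exists j, w o j != 0]]]|.
elim: n w w0 wC => // n IHn w w0 wC; rewrite ltnS => le_n.
have [/existsP[o /and3P[ox oy /existsP[k wok]]]|/existsPn small] :=
    boolP [exists o, [&& o != x, o != y & [exists j, w o j != 0]]].
  have a0 i : 0 <= branches w o i by rewrite /branches; case: ifP.
  have m0 i j : 0 <= mesh w o i j.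
    rewrite /mesh /remainder addr_ge0 //; first by case: ifP.
    by rewrite divr_ge0 ?mulr_ge0 ?sumr_ge0.
  have mC i j : mesh w o i j = mesh w o j i.
    by rewrite /mesh /remainder orbC wC; ring.
  have mo j : mesh w o o j = 0.
    by rewrite /mesh /remainder /branches eqxx /= !mul0r addr0.
  have [|h [hx hy le_h]] := IHn _ m0 mC.
    apply: leq_trans le_n; apply: proper_card; apply/properP; split.
      apply/fintype.subsetP => i; rewrite !inE.
      move=> /and3P[-> -> /existsP[j mij]] /=.
      have io : i != o by apply: contraNneq mij => ->; rewrite mo.
      have jo : j != o by apply: contraNneq mij => ->; rewrite mC mo.
      apply/existsP; have [wij|] := eqVneq (w i j) 0; last by exists j.
      exists o; apply: contraNneq mij => wio.
      rewrite /mesh /remainder /branches (negPf io) (negPf jo) /= wij wC wio.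
      by rewrite !mul0r addr0.
    exists o; rewrite !inE ox oy /=; first by apply/existsP; exists k.
    by apply/existsPn => j; rewrite mo eqxx.
  have [h' [h'E enE]] := harmonic_extension o h w0 wC.
  exists h'; split; [by rewrite h'E // eq_sym|by rewrite h'E // eq_sym|].
  by rewrite enE (le_trans le_h) // pairing_mesh_le.
exists (fun i => (i == x)%:R); split; rewrite ?eqxx //.
  by rewrite eq_sym (negPf xy).
rewrite /pairing big_distrl; apply: ler_sum => i _.
rewrite big_distrl; apply: ler_sum => j _.
have [->|wij] /= := eqVneq (w i j) 0; first by rewrite !mul0r.
have ixy : (i == x) || (i == y).
  apply: contraR (small i); rewrite negb_or => /andP[-> ->] /=.
  by apply/existsP; exists j.
have jxy : (j == x) || (j == y).
  apply: contraR (small j); rewrite negb_or => /andP[-> ->] /=.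
  by apply/existsP; exists i; rewrite wC.
rewrite -mulrA ler_wpM2l //.
have yx : (y == x) = false by rewrite eq_sym (negPf xy).
move: ixy jxy => /orP[]/eqP-> /orP[]/eqP->;
  rewrite ?eqxx ?yx ?dd ?(dC y x) /=; lra.
Qed.

End Reduction.
End Network.

(** The octopus inequality for the weights a_i off o and - sum_k a_k at o. *)
Lemma octopus_star_mesh (R : realFieldType) (V : finType)
    (beta : {perm V} -> R) :
  positive_definite beta ->
  star_mesh_le (fun i j => beta 1%g - beta (tperm i j)).
Proof.
move=> beta_pd a o a0 ao.
set d := fun i j : V => beta 1%g - beta (tperm i j); set W := \sum_i a i.
pose c i := a i - (i == o)%:R * W.
have delta (F : V -> R) : \sum_i (i == o)%:R * F i = F o.
  rewrite (bigD1 o) //= big1 ?addr0 ?eqxx ?mul1r // => i /negPf ->.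
  by rewrite mul0r.
have c_sum0 : \sum_i c i = 0 by rewrite sumrB delta subrr.
have c_ge0 i : i != o -> 0 <= c i.
  by rewrite /c => /negPf ->; rewrite mul0r subr0.
have := octopus beta_pd c_sum0 c_ge0.
have -> : \sum_i \sum_j c i * c j * beta (tperm i j) =
    - \sum_i \sum_j c i * c j * d i j.
  apply/eqP; rewrite -addr_eq0 -big_split big1 // => i _ /=.
  rewrite -big_split /= (eq_bigr (fun j => c i * c j * beta 1%g)).
    by rewrite -big_distrl -big_distrr /= c_sum0 mulr0 mul0r.
  by move=> j _; rewrite /d; ring.
have -> : \sum_i \sum_j c i * c j * d i j = \sum_i \sum_j a i * a j * d i j
    - 2 * W * \sum_i a i * d o i.
  have -> : \sum_i \sum_j c i * c j * d i j = \sum_i (\sum_j a i * a j * d i j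
      - (W * (a i * d o i) + (i == o)%:R * (W * (\sum_j a j * d o j)))).
    apply: eq_bigr => i _.
    have -> : W * (a i * d o i) = \sum_j (j == o)%:R * (W * (a i * d i j)).
      by rewrite delta /d tpermC.
    rewrite big_distrr /= big_distrr -big_split -sumrB.
    apply: eq_bigr => j _ /=; rewrite /c.
    case: (eqVneq i o) => [->|io]; case: (eqVneq j o) => [->|jo] /=;
      rewrite /d ?ao ?tperm1; ring.
  rewrite sumrB big_split /= delta -big_distrr /=; ring.
by rewrite oppr_ge0 subr_le0.
Qed.

(** * The exclusion process *)

Section Exclusion.
Variables (R : realType) (V : finType) (alpha : R).
Implicit Types (zeta : config V) (s t : {perm V}) (f h : config V -> R).

Definition relabel zeta s : config V := [ffun z => zeta (s z)].

Lemma relabelM zeta s t : relabel (relabel zeta s) t = relabel zeta (t * s)%g.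
Proof. by apply/ffunP => z; rewrite !ffunE permM. Qed.

Lemma relabel1 zeta : relabel zeta 1%g = zeta.
Proof. by apply/ffunP => z; rewrite ffunE perm1. Qed.

Lemma swapE x y zeta : swap x y zeta = relabel zeta (tperm x y).
Proof.
apply/ffunP => z; rewrite !ffunE permE /=.
by case: eqP => // _; case: eqP.
Qed.

Lemma nuD (h1 h2 : config V -> R) :
  nu alpha (fun zeta => h1 zeta + h2 zeta)
  = nu alpha h1 + nu alpha h2 :> R.
Proof.
by rewrite /nu -big_split; apply: eq_bigr => zeta _; rewrite mulrDr.
Qed.

Lemma nuZ a h : nu alpha (fun zeta => a * h zeta) = a * nu alpha h.
Proof. by rewrite /nu big_distrr; apply: eq_bigr => zeta _; rewrite mulrCA. Qed.

Lemma nu_sum (I : Type) (r : seq I) (P : pred I) (h : I -> config V -> R) :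
  nu alpha (fun zeta => \sum_(i <- r | P i) h i zeta) =
  \sum_(i <- r | P i) nu alpha (h i).
Proof.
by rewrite /nu exchange_big; apply: eq_bigr => zeta _; rewrite big_distrr.
Qed.

Lemma eq_nu (h1 h2 : config V -> R) :
  h1 =1 h2 -> nu alpha h1 = nu alpha h2 :> R.
Proof. by move=> h12; apply: eq_bigr => zeta _; rewrite h12. Qed.

(** The product measure is exchangeable. *)
Lemma nu_relabel s (h : config V -> R) :
  nu alpha (fun zeta => h (relabel zeta s)) = nu alpha h.
Proof.
rewrite /nu [RHS](reindex (relabel^~ s)) /=; last first.
  exists (relabel^~ s^-1%g) => zeta _; rewrite relabelM ?mulgV ?mulVg;
  exact: relabel1.
apply: eq_bigr => zeta _; congr (_ * _); rewrite /nu_mass.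
by rewrite (reindex_perm s); apply: eq_bigr => z _; rewrite ffunE.
Qed.

Definition correlation f s : R :=
  nu alpha (fun zeta => f zeta * f (relabel zeta s)).

Lemma correlation_pair f s t :
  nu alpha (fun zeta => f (relabel zeta s) * f (relabel zeta t))
  = correlation f (s * t^-1)%g.
Proof.
rewrite -(nu_relabel t^-1%g); apply: eq_nu => zeta.
by rewrite !relabelM mulgV relabel1 mulrC.
Qed.

Hypothesis alpha01 : 0 <= alpha <= 1.

Lemma nu_ge0 h : (forall zeta, 0 <= h zeta) -> 0 <= nu alpha h.
Proof.
move=> h0; apply: sumr_ge0 => zeta _; rewrite mulr_ge0 //.
have /andP[a0 a1] := alpha01.
by apply: prodr_ge0 => z _; case: ifP; rewrite ?subr_ge0.
Qed.

Lemma correlation_positive_definite f : positive_definite (correlation f).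
Proof.
split=> [s|I r a s].
  rewrite -[s^-1%g]mul1g -correlation_pair /correlation; apply: eq_nu => zeta.
  by rewrite relabel1 mulrC.
rewrite (_ : \sum_(_ <- r) _ =
    nu alpha (fun zeta => (\sum_(p <- r) a p * f (relabel zeta (s p))) ^+ 2)).
  by apply: nu_ge0 => zeta; rewrite sqr_ge0.
under eq_bigr => p _ do under eq_bigr => q _ do rewrite -correlation_pair -nuZ.
under eq_bigr => p _ do rewrite -nu_sum.
rewrite -nu_sum; apply: eq_nu => zeta.
rewrite expr2 big_distrl; apply: eq_bigr => p _ /=.
by rewrite big_distrr; apply: eq_bigr => q _ /=; ring.
Qed.

Definition exchange_energy f x y : R :=
  correlation f 1%g - correlation f (tperm x y).

Lemma nu_grad_sqr f x y :
  1 / 2 * nu alpha (fun zeta => (grad x y f zeta) ^+ 2) = exchange_energy f x y.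
Proof.
pose s := tperm x y.
have -> : nu alpha (fun zeta => (grad x y f zeta) ^+ 2) = correlation f 1%g
    + (nu alpha (fun zeta => f (relabel zeta s) * f (relabel zeta s))
       + -2 * correlation f s).
  rewrite /correlation -nuZ -!nuD; apply: eq_nu => zeta.
  by rewrite /grad swapE relabel1 -/s; ring.
by rewrite correlation_pair mulgV /exchange_energy -/s; field.
Qed.

Lemma nu_grad_mul f x y :
  nu alpha (fun zeta => f zeta * - grad x y f zeta) = exchange_energy f x y.
Proof.
rewrite /exchange_energy /correlation -mulN1r -nuZ -nuD; apply: eq_nu => zeta.
by rewrite /grad swapE relabel1; ring.
Qed.

Lemma energy_EXE (e : rel V) (c : V -> V -> R) f :
  energy_EX e c alpha f = edge_sum e (fun z w => c z w * exchange_energy f z w).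
Proof.
rewrite /energy_EX /edge_sum -(eq_bigr _ (fun p _ =>
  congr1 (fun r => c p.1 p.2 * r) (nu_grad_mul f p.1 p.2))).
under [RHS]eq_bigr => p _ do rewrite -nuZ.
rewrite -nu_sum; apply: eq_nu => zeta; rewrite /gen_EX /edge_sum.
rewrite -sumrN big_distrr; apply: eq_bigr => p _ /=; ring.
Qed.

Lemma exchange_energyC f x y : exchange_energy f x y = exchange_energy f y x.
Proof. by rewrite /exchange_energy tpermC. Qed.

Lemma exchange_energyxx f x : exchange_energy f x x = 0.
Proof. by rewrite /exchange_energy tperm1 subrr. Qed.

Lemma exchange_energy_ge0 f x y : 0 <= exchange_energy f x y.
Proof.
rewrite -nu_grad_sqr mulr_ge0 ?divr_ge0 //.
by apply: nu_ge0 => zeta; rewrite sqr_ge0.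
Qed.

End Exclusion.

Definition weight_of (R : realType) (V : finType) (e : rel V)
    (c : V -> V -> R) i j : R :=
  if e i j then c i j else 0.

Lemma pairing_edge_sum (R : realType) (V : finType) (e : rel V)
    (c F : V -> V -> R) :
  symmetric e -> irreflexive e -> (forall i j, e i j -> c i j = c j i) ->
  (forall i j, F i j = F j i) ->
  pairing (weight_of e c) F = 2 * edge_sum e (fun i j => c i j * F i j).
Proof.
move=> eC eI cC FC.
rewrite /pairing pair_bigA /=.
rewrite (bigID (fun p : V * V => (enum_rank p.1 < enum_rank p.2)%N)) /=.
have sw : {on [pred p : V * V | ~~ (enum_rank p.1 < enum_rank p.2)%N],
    bijective (fun p : V * V => (p.2, p.1))}.
  by exists (fun p => (p.2, p.1)) => -[].
rewrite [X in _ + X](reindex _ sw) /= mulr_natl mulr2n /edge_sum; congr (_ + _).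
  rewrite big_mkcond [RHS]big_mkcond; apply: eq_bigr => -[i j] _ /=.
  by rewrite /weight_of; case: (e i j); case: ifP => //; rewrite mul0r.
rewrite big_mkcond [RHS]big_mkcond; apply: eq_bigr => -[i j] _ /=.
rewrite /weight_of eC; case: (boolP (e i j)) => [eij|_] /=; last first.
  by case: ifP; rewrite // mul0r.
rewrite -leqNgt leq_eqVlt (_ : (_ == _) = false) /=; last first.
  by apply: contraTF eij => /eqP/val_inj/enum_rank_inj ->; rewrite eI.
by case: ifP => // _; rewrite -cC // FC.
Qed.

Theorem theorem1 (R : realType) (V : finType) (e : rel V) (c : V -> V -> R)
    (e_sym : symmetric e) (e_irr : irreflexive e)
    (e_conn : forall x y : V, connect e x y)
    (c_sym : forall z w : V, e z w -> c z w = c w z)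
    (c_ge0 : forall z w : V, e z w -> 0 <= c z w)
    (Reff_fin : forall x y : V, Reff e c x y \is a fin_num)
    (alpha : R) (alpha01 : 0 <= alpha <= 1)
    (x y : V) (f : config V -> R) :
  ((1 / 2 * nu alpha (fun zeta => (grad x y f zeta) ^+ 2))%:E
    <= Reff e c x y * (energy_EX e c alpha f)%:E)%E.
Proof.
rewrite nu_grad_sqr energy_EXE; set d := exchange_energy alpha f.
have := Reff_fin x y; rewrite /Reff; case: eqVneq => [->|xy].
  by rewrite /d exchange_energyxx mul0e.
pose D (h : V -> R) := edge_sum e (fun z w => c z w * (h z - h w) ^+ 2).
have D0 h : 0 <= D h.
  by apply: sumr_ge0 => p /andP[ep _]; rewrite mulr_ge0 ?sqr_ge0 ?c_ge0.
have w0 i j : 0 <= weight_of e c i j.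
  by rewrite /weight_of; case: ifP => // /c_ge0.
have wC i j : weight_of e c i j = weight_of e c j i.
  by rewrite /weight_of e_sym; case: ifP => // eji; rewrite c_sym // e_sym.
have d_star := octopus_star_mesh (correlation_positive_definite alpha01 f).
have [h [hx hy]] := network_reduction (exchange_energy_ge0 alpha01 f)
  (exchange_energyC alpha f) (exchange_energyxx alpha f) d_star w0 wC xy.
rewrite !pairing_edge_sum //; last 2 first.
- exact: exchange_energyC.
- by move=> i j; ring.
rewrite -/(D h) -mulrA ler_pM2l // => le_d.
set I := conductance_inf e c x y => I_fin.
have I_le : I <= D h.
  apply: ge_inf; last by exists h.
  by exists 0 => _ [k _ <-]; exact: D0.
have I_ge0 : 0 <= I.
  by apply: lb_le_inf; [exists (D h), h|move=> _ [k _ <-]; exact: D0].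
have IN0 : I != 0 by apply: contraTneq I_fin => ->; rewrite inve0.
have I_gt0 : 0 < I by rewrite lt_def IN0.
rewrite inver (negPf IN0) -EFinM lee_fin ler_pdivlMl //.
by apply: le_trans le_d; rewrite ler_wpM2r // exchange_energy_ge0.
Qed.
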